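(* Let $k$ be a positive integer, and let $\mathcal{G}$ be a class of graphs that is $\chi$-bounded by a non-decreasing function $f:\mathbb{N}\rightarrow\mathbb{R}$. Then $\mathcal{G}^k$ is $\chi$-bounded by the function $g:\mathbb{N}\rightarrow\mathbb{R}$ given by $g(n)=f(n)+2k^2-1$.
   Context: All graphs are finite and simple, possibly empty; $\omega$ is the clique number and $\chi$ the chromatic number. A class $\mathcal{G}$ is $\chi$-bounded by $f$ if for all $G\in\mathcal{G}$ and all (possibly empty) induced subgraphs $H$ of $G$, $\chi(H)\leq f(\omega(H))$. Gluing: let $G_1,G_2$ be non-empty graphs with inclusion-wise incomparable vertex sets, $C=V_{G_1}\cap V_{G_2}$, and $G_1[C]=G_2[C]$; the graph $G$ with $V_G=V_{G_1}\cup V_{G_2}$, $G[V_{G_1}]=G_1$, $G[V_{G_2}]=G_2$, and $V_{G_1}\smallsetminus C$ anti-complete to $V_{G_2}\smallsetminus C$ is obtained by gluing $G_1$ and $G_2$ along $C$ (along $|C|$ vertices). $\mathcal{G}^k$ denotes the closure of $\mathcal{G}$ under gluing along at most $k$ vertices, i.e., under the operation of gluing any two such graphs with $|C|\leq k$. *)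

(* Defs.v *)
From mathcomp Require Import all_boot all_order all_algebra finmap.
From mathcomp Require Import reals.

Set Implicit Arguments.
Unset Strict Implicit.
Unset Printing Implicit Defensive.

Import Order.TTheory GRing.Theory Num.Theory.

Local Open Scope fset_scope.

(* Finite simple graphs whose vertices are drawn from an ambient type U, so
   that two graphs may share vertices. Edges are 2-element sets of vertices;
   hence [=] on [graph U] is equality of vertex sets and of edge sets. *)
Definition graph_axiom (U : choiceType) (V : {fset U}) (E : {fset {fset U}}) :=
  all (fun e : {fset U} => (e `<=` V) && (#|` e| == 2)) (enum_fset E).

Record graph (U : choiceType) := Graph {
  vertices : {fset U};
  edges : {fset {fset U}};
  _ : graph_axiom vertices edges }.

Lemma graphP (U : choiceType) (G : graph U) (e : {fset U}) :
  e \in edges G -> (e `<=` vertices G) && (#|` e| == 2).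
Proof. by case: G => V E /= /allP; apply. Qed.

Lemma graph_eq (U : choiceType) (G H : graph U) :
  vertices G = vertices H -> edges G = edges H -> G = H.
Proof.
case: G H => [V E p] [W F q] /= eqV eqE; case: W / eqV q; case: F / eqE => q.
by rewrite (bool_irrelevance p q).
Qed.

Definition adj (U : choiceType) (G : graph U) (x y : U) : bool :=
  [fset x; y] \in edges G.

Fact induced_subproof (U : choiceType) (G : graph U) (X : {fset U}) :
  graph_axiom (vertices G `&` X) [fset e in edges G | e `<=` X].
Proof.
apply/allP => e; rewrite !inE /= => /andP[/graphP/andP[sV s2] sX].
by rewrite fsubsetI sV sX s2.
Qed.

Definition induced (U : choiceType) (G : graph U) (X : {fset U}) : graph U :=
  Graph (induced_subproof G X).

Definition clique (U : choiceType) (G : graph U) (K : {set vertices G}) : bool :=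
  [forall x in K, forall y in K, (x != y) ==> adj G (val x) (val y)].

Definition omega (U : choiceType) (G : graph U) : nat :=
  \max_(K : {set vertices G} | clique K) #|K|.

Definition proper_coloring (U : choiceType) (G : graph U) (c : nat)
    (col : {ffun vertices G -> 'I_c}) : bool :=
  [forall x, forall y, adj G (val x) (val y) ==> (col x != col y)].

Definition colorable (U : choiceType) (G : graph U) (c : nat) : bool :=
  [exists col : {ffun vertices G -> 'I_c}, proper_coloring col].

Fact colorable_exists (U : choiceType) (G : graph U) : exists c, colorable G c.
Proof.
exists #|{: vertices G}|; apply/existsP; exists [ffun x => enum_rank x].
apply/forallP => x; apply/forallP => y; apply/implyP => /graphP/andP[_].
by rewrite !ffunE (inj_eq enum_rank_inj) cardfs2 -val_eqE; case: (val x == _).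
Qed.

Definition chi (U : choiceType) (G : graph U) : nat :=
  ex_minn (colorable_exists G).

Definition chi_bounded_by (R : realType) (U : choiceType)
    (cls : graph U -> Prop) (f : nat -> R) : Prop :=
  forall G : graph U, cls G ->
  forall X : {fset U}, X `<=` vertices G ->
  ((chi (induced G X))%:R <= f (omega (induced G X)))%R.

Record glued (U : choiceType) (G1 G2 G : graph U) : Prop := Glued {
  glued_nonempty1 : vertices G1 != fset0;
  glued_nonempty2 : vertices G2 != fset0;
  glued_incomparable12 : ~~ (vertices G1 `<=` vertices G2);
  glued_incomparable21 : ~~ (vertices G2 `<=` vertices G1);
  glued_agree : induced G1 (vertices G1 `&` vertices G2)
              = induced G2 (vertices G1 `&` vertices G2);
  glued_vertices : vertices G = vertices G1 `|` vertices G2;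
  glued_induced1 : induced G (vertices G1) = G1;
  glued_induced2 : induced G (vertices G2) = G2;
  glued_anticomplete : forall x y,
    x \in vertices G1 `\` (vertices G1 `&` vertices G2) ->
    y \in vertices G2 `\` (vertices G1 `&` vertices G2) ->
    ~~ adj G x y }.

Inductive gluing_closure (U : choiceType) (k : nat) (cls : graph U -> Prop) :
    graph U -> Prop :=
| GluingBase G : cls G -> gluing_closure k cls G
| GluingStep G1 G2 G :
    gluing_closure k cls G1 -> gluing_closure k cls G2 ->
    #|` vertices G1 `&` vertices G2| <= k -> glued G1 G2 G ->
    gluing_closure k cls G.

(* Main.v *)
Require Import Defs.
From mathcomp Require Import all_boot all_order all_algebra finmap.
From mathcomp Require Import reals.
From mathcomp Require Import zify.

(** In the closure, every vertex set either lies in a graph of the class or is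
    separated by at most [k] vertices.  So it suffices to find, in a graph [X]
    of minimum degree at least [2k^2], a set [Y] that has no such separation,
    has fewer than [2k^2] vertices with neighbours outside [Y], and has a vertex
    with none: colour everything but the interior of [Y] by induction, and
    colour the interior with [c] colours unused on the boundary of [Y].
    Vertices of degree below [2k^2] are coloured greedily.

    To find [Y], give [v] in [Y] the weight [min(k, d)], where [d] is the number
    of its neighbours outside [Y].  An inclusion-minimal [Y] with an interior
    vertex and total weight below [2k^2] works: for a separation [(A, B)] of
    [Y], if both sides have interior vertices, their total weights sum to at
    most that of [Y] plus [2k^2]; if [A] has none, the degree condition makes
    the weight on [A \ B] pay for the new weight on [A n B], so that passing
    to [B] does not increase the total weight. *)

Set Implicit Arguments.
Unset Strict Implicit.
Unset Printing Implicit Defensive.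

(** * Separations of vertex sets in a finite graph *)

Section FiniteGraph.

Variables (T : finType) (e : rel T) (k : nat).
Hypotheses (e_sym : symmetric e) (e_irr : irreflexive e).
Implicit Types (Y Z A B : {set T}) (u v : T).

Definition separation (Y A B : {set T}) : Prop :=
  [/\ Y = A :|: B, A :\: B != set0, B :\: A != set0, #|A :&: B| <= k
    & forall x y, x \in A :\: B -> y \in B :\: A -> ~~ e x y].

Definition nbrs (X : {set T}) (v : T) : {set T} := [set u in X | e v u].

Lemma separationC Y A B : separation Y A B -> separation Y B A.
Proof.
case=> -> nA nB cS anti; split; rewrite // 1?setUC 1?setIC //.
by move=> x y xB yA; rewrite e_sym anti.
Qed.

Lemma separation_properl Y A B : separation Y A B -> A \proper Y.
Proof.
case=> -> _ /set0Pn[x xBA] _ _; rewrite properE subsetUl /=.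
apply/subsetPn; exists x; move: xBA; rewrite !inE => /andP[xA xB] //.
by rewrite xB orbT.
Qed.

(** * Weights and the inseparable set *)

Section Isolation.

Variable X : {set T}.
Hypothesis k_gt0 : 0 < k.
Hypothesis deg_ge : forall v, v \in X -> 2 * k ^ 2 <= #|nbrs X v|.

Definition weight (Y : {set T}) (v : T) : nat := minn k #|nbrs (X :\: Y) v|.

Definition potential (Y : {set T}) : nat := \sum_(v in Y) weight Y v.

Definition has_interior (Y : {set T}) : bool :=
  [exists v in Y, nbrs (X :\: Y) v == set0].

Lemma weight_le Y v : weight Y v <= k.
Proof. exact: geq_minl. Qed.

(** No edge joins [A :\: B] to [B :\: A], so shrinking [Y] to [A] uncovers no neighbour of [v]. *)
Lemma separation_nbrsE Y A B v : separation Y A B ->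
  v \in A :\: B -> nbrs (X :\: A) v = nbrs (X :\: Y) v.
Proof.
move=> [-> _ _ _ anti] vA; apply/setP => u; rewrite !inE.
case uA: (u \in A) => //=; case uB: (u \in B) => //=.
have uBA : u \in B :\: A by rewrite !inE uA uB.
by rewrite (negbTE (anti v u vA uBA)) andbF.
Qed.

Lemma separation_weight_le Y A B v : separation Y A B ->
  weight A v <= weight Y v + #|B :\: A|.
Proof.
case=> -> _ _ _ _.
have: #|nbrs (X :\: A) v| <= #|nbrs (X :\: (A :|: B)) v| + #|B :\: A|.
  apply: leq_trans (leq_card_setU _ _); apply/subset_leq_card/subsetP => u.
  rewrite !inE; case: (u \in A) => //=; case: (u \in B) => //=.
  by rewrite orbF.
rewrite /weight; lia.
Qed.

Lemma sum_setID (A B : {set T}) (F : T -> nat) :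
  \sum_(v in A) F v = \sum_(v in A :\: B) F v + \sum_(v in A :&: B) F v.
Proof. by rewrite (big_setID B) /= addnC. Qed.

Lemma potential_sep Y A B : separation Y A B ->
  potential Y = \sum_(v in A :\: B) weight Y v + \sum_(v in A :&: B) weight Y v
              + \sum_(v in B :\: A) weight Y v.
Proof.
case=> YE _ _ _ _; rewrite /potential (big_setID A) /=.
have -> : Y :&: A = A by rewrite YE setUK.
have -> : Y :\: A = B :\: A by rewrite YE setDUl setDv set0U.
by rewrite (sum_setID A B).
Qed.

Lemma sum_weight_le Y (Z : {set T}) : \sum_(v in Z) weight Y v <= k * #|Z|.
Proof.
by rewrite mulnC -sum_nat_const; apply: leq_sum => v _; apply: weight_le.
Qed.

Lemma potential_side Y A B : separation Y A B ->
  potential A = \sum_(v in A :\: B) weight Y v + \sum_(v in A :&: B) weight A v.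
Proof.
move=> sep; rewrite /potential (sum_setID A B); congr (_ + _).
by apply: eq_bigr => v vA; rewrite /weight (separation_nbrsE sep).
Qed.

Lemma potential_side_le Y A B : separation Y A B ->
  potential A <= \sum_(v in A :\: B) weight Y v + k ^ 2.
Proof.
move=> sep; rewrite (potential_side sep) leq_add2l.
apply: leq_trans (sum_weight_le _ _) _; case: sep => _ _ _ cS _.
by rewrite expnS expn1 leq_mul.
Qed.

(** Only the at most [k] separator vertices gain weight, each by at most the number of deleted
    vertices; this is the useful bound when [B :\: A] is small. *)
Lemma potential_side_le_card Y A B : separation Y A B ->
  potential A <= \sum_(v in A :\: B) weight Y v
                 + \sum_(v in A :&: B) weight Y v + k * #|B :\: A|.
Proof.
move=> sep; rewrite (potential_side sep) -addnA leq_add2l.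
apply: (@leq_trans (\sum_(v in A :&: B) (weight Y v + #|B :\: A|))).
  by apply: leq_sum => v _; apply: separation_weight_le sep.
rewrite big_split /= sum_nat_const leq_add2l; case: sep => _ _ _ cS _.
by rewrite leq_mul.
Qed.

Lemma no_interior_nbrs Y A B v : separation Y A B ->
  ~~ has_interior A -> v \in A :\: B -> 0 < #|nbrs (X :\: Y) v|.
Proof.
move=> sep nA vA; rewrite -(separation_nbrsE sep vA) lt0n cards_eq0.
apply: contraNneq nA => v0; apply/existsP; exists v.
by move: vA; rewrite inE => /andP[_ ->]; rewrite v0 eqxx.
Qed.

(** Within [Y], the neighbours of [v] all lie in [A]; as [v] is not its own neighbour, the
    inequality is strict. *)
Lemma outer_degree_ge Y A B v : Y \subset X -> separation Y A B ->
  v \in A :\: B -> 2 * k ^ 2 < #|nbrs (X :\: Y) v| + #|A :\: B| + k.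
Proof.
move=> YX sep vAB; have AY := proper_sub (separation_properl sep).
have vA : v \in A by move: vAB; rewrite inE => /andP[].
have degv := deg_ge (subsetP YX v (subsetP AY v vA)).
rewrite -(separation_nbrsE sep vAB).
have: #|nbrs X v| <= #|nbrs (X :\: A) v| + #|A :\ v|.
  apply: leq_trans (leq_card_setU _ _); apply/subset_leq_card/subsetP => u.
  rewrite !inE => /andP[uX evu]; rewrite uX evu /=; case: (u \in A) => //=.
  by rewrite andbT; apply: contraTneq evu => ->; rewrite e_irr.
move: (cardsD1 v A) (cardsID B A); rewrite vA.
case: sep => _ _ _; lia.
Qed.

(** By [outer_degree_ge] each of these vertices has at least [k] neighbours outside [Y], so the
    minimum in [weight] is [k]. *)
Lemma sum_weight_full Y A B : Y \subset X -> separation Y A B ->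
  #|A :\: B| + 2 * k <= 2 * k ^ 2 + 1 ->
  \sum_(v in A :\: B) weight Y v = k * #|A :\: B|.
Proof.
move=> YX sep small; rewrite mulnC -sum_nat_const; apply: eq_bigr => v vA.
move: (outer_degree_ge YX sep vA); rewrite /weight; lia.
Qed.

Lemma sum_weight_ge Y A B : separation Y A B ->
  ~~ has_interior A -> #|A :\: B| <= \sum_(v in A :\: B) weight Y v.
Proof.
move=> sep nA; rewrite -sum1_card; apply: leq_sum => v vA.
by rewrite /weight leq_min k_gt0 (no_interior_nbrs sep).
Qed.

(** Deleting [A :\: B] loses at least what the separator gains: a loss of [k * #|A :\: B|] covers a
    gain of at most [#|A :\: B|] at each of at most [k] vertices, and a loss of [k ^ 2] covers the
    largest possible weight of the separator. *)
Lemma potential_side_le_whole Y A B : Y \subset X -> separation Y A B ->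
  ~~ has_interior A -> potential B <= potential Y.
Proof.
move=> YX sep nA; have sepC := separationC sep.
have := potential_side_le sepC; have := potential_side_le_card sepC.
rewrite (potential_sep sep) [B :&: A]setIC.
have := sum_weight_ge sep nA; have := sum_weight_full YX sep.
(* Either every vertex of [A :\: B] has weight [k], or [#|A :\: B| >= k ^ 2]. *)
case: (leqP (#|A :\: B| + 2 * k) (2 * k ^ 2 + 1)) => [_ /(_ isT)->|]; first lia.
nia.
Qed.

(** An interior vertex of [Y] has all its neighbours in [Y], so [#|Y| > 2 * k ^ 2], while every
    vertex off the separator weighs at least 1. *)
Lemma potential_ge_no_interiors Y A B : Y \subset X -> separation Y A B ->
  has_interior Y -> ~~ has_interior A -> ~~ has_interior B ->
  #|A :\: B| <= #|B :\: A| -> 2 * k ^ 2 <= potential Y.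
Proof.
move=> YX sep /existsP[u /andP[uY /eqP u0]] nA nB leAB.
have := sum_weight_ge sep nA; have := sum_weight_full YX sep.
have := sum_weight_ge (separationC sep) nB.
have YE := potential_sep sep.
have Ycard: 2 * k ^ 2 < #|Y|.
  apply: leq_ltn_trans (deg_ge (subsetP YX u uY)) _.
  rewrite (cardsD1 u Y) uY add1n ltnS; apply/subset_leq_card/subsetP => v.
  rewrite !inE => /andP[vX euv]; apply/andP; split.
    by apply: contraTneq euv => ->; rewrite e_irr.
  by apply: contraT => vY; have := in_set0 v; rewrite -u0 !inE vX vY euv.
have Ysplit : #|Y| = #|A :\: B| + #|A :&: B| + #|B :\: A|.
  case: sep => -> _ _ _ _; rewrite -(cardsID A (A :|: B)) setUK.
  by rewrite setDUl setDv set0U -(cardsID B A); lia.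
case: sep => _; rewrite -card_gt0 => A0 _ cS _.
(* More than [2k^2 - k] vertices lie off the separator. If [A :\: B] has at most [2k^2 - 2k + 1]
   vertices, each weighs [k], and even one of them supplies the missing [k - 1]. Otherwise both
   sides are large, and together they have at least [2(2k^2 - 2k + 2) >= 2k^2] vertices. *)
nia.
Qed.

Lemma potential_side_lt Y A B : Y \subset X -> separation Y A B ->
  has_interior Y -> potential Y < 2 * k ^ 2 ->
  (has_interior A && (potential A < 2 * k ^ 2)) ||
  (has_interior B && (potential B < 2 * k ^ 2)).
Proof.
move=> YX sep iY pY; have sepC := separationC sep.
case iA: (has_interior A); case iB: (has_interior B) => /=.
(* The two potentials sum to less than [4k^2], so one of them is below [2k^2]. *)
- have := potential_side_le sep; have := potential_side_le sepC.
  move: pY; rewrite (potential_sep sep); lia.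
- by rewrite orbF (leq_ltn_trans (potential_side_le_whole YX sepC _)) // iB.
- by rewrite (leq_ltn_trans (potential_side_le_whole YX sep _)) // iA.
case: (leqP #|A :\: B| #|B :\: A|) => [|/ltnW] le.
  by move: (potential_ge_no_interiors YX sep iY (negbT iA) (negbT iB) le); lia.
by move: (potential_ge_no_interiors YX sepC iY (negbT iB) (negbT iA) le); lia.
Qed.

Lemma inseparable_piece_exists : X != set0 ->
  exists Y, [/\ Y \subset X, has_interior Y, potential Y < 2 * k ^ 2
              & forall A B, ~ separation Y A B].
Proof.
move=> /set0Pn[x xX].
pose Q Y := [&& Y \subset X, has_interior Y & potential Y < 2 * k ^ 2].
have nbrs0 v : nbrs (X :\: X) v = set0.
  by apply/setP => u; rewrite !inE andNb.
(* Nothing of [X] lies outside [X], so all its vertices are interior and its potential is 0. *)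
have QX : Q X.
  apply/and3P; split=> //; first by apply/existsP; exists x; rewrite xX nbrs0 /=.
  rewrite /potential big1 ?muln_gt0 ?expn_gt0 ?k_gt0 // => v _.
  by rewrite /weight nbrs0 cards0 minn0.
have [Y /minsetP[/and3P[YX iY pY] minY] _] := minset_exists QX.
exists Y; split=> // A B sep; have sepC := separationC sep.
have pA := separation_properl sep; have pB := separation_properl sepC.
case/orP: (potential_side_lt YX sep iY pY) => /andP[iZ pZ].
- suff AY : A = Y by rewrite AY properxx in pA.
  by apply: minY (proper_sub pA); rewrite /Q iZ pZ (subset_trans (proper_sub pA)).
- suff BY : B = Y by rewrite BY properxx in pB.
  by apply: minY (proper_sub pB); rewrite /Q iZ pZ (subset_trans (proper_sub pB)).
Qed.

End Isolation.

(** * Extending colourings across a small boundary *)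

Definition colors (X : {set T}) (n : nat) (col : T -> nat) : Prop :=
  (forall x, x \in X -> col x < n) /\
  (forall x y, x \in X -> y \in X -> e x y -> col x != col y).

Lemma colorsS (X Y : {set T}) n col :
  Y \subset X -> colors X n col -> colors Y n col.
Proof.
move=> /subsetP YX [colX propX]; split=> [x /YX|x y /YX xX /YX yX]; auto.
Qed.

Lemma size_unused n (s : seq nat) :
  n <= size [seq i <- iota 0 n | i \notin s] + size s.
Proof.
have le_s : count (mem s) (iota 0 n) <= size s.
  rewrite -size_filter; apply: uniq_leq_size; first exact/filter_uniq/iota_uniq.
  by move=> i; rewrite mem_filter => /andP[].
move: (count_predC (mem s) (iota 0 n)); rewrite size_iota size_filter.
rewrite (@eq_count _ (predC (mem s)) (fun i => i \notin s)) //; lia.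
Qed.

(** At least [c] of the [n] colours are missing from [N], which contains every neighbour of [I] in
    the rest of [X]; [col1] is renamed into these. *)
Lemma colors_extend (X I N : {set T}) c n col0 col1 :
  colors (X :\: I) n col0 -> colors I c col1 -> #|N| + c <= n ->
  (forall x y, x \in I -> y \in X :\: I -> e x y -> y \in N) ->
  exists col, colors X n col.
Proof.
move=> [lt0 prop0] [lt1 prop1] cN Nnbr.
pose s := [seq col0 y | y in N].
pose L := [seq i <- iota 0 n | i \notin s].
have szL : c <= size L by have := size_unused n s; rewrite size_map -cardE -/L; lia.
have Luniq : uniq L by apply/filter_uniq/iota_uniq.
(* The default 0 of [nth] is never reached, since [col1] stays below [c <= size L] on [I]. *)
have memL x : x \in I -> nth 0 L (col1 x) \in L.
  by move=> xI; rewrite mem_nth // (leq_trans (lt1 x xI)).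
have cross x y : x \in I -> y \in X :\: I -> e x y -> nth 0 L (col1 x) != col0 y.
  move=> xI yX exy; have := memL x xI; rewrite mem_filter => /andP[+ _].
  by apply: contraNneq => ->; apply: image_f; apply: Nnbr exy.
exists (fun x => if x \in I then nth 0 L (col1 x) else col0 x).
split=> [x xX|x y xX yX exy]; case xI: (x \in I).
- by have := memL x xI; rewrite mem_filter mem_iota => /andP[].
- by apply: lt0; rewrite inE xI.
- case yI: (y \in I); last by apply: cross => //; rewrite inE yI.
  rewrite nth_uniq ?(leq_trans (lt1 _ _)) //; exact: prop1.
case yI: (y \in I).
  by rewrite eq_sym; apply: cross; rewrite ?inE ?xI // e_sym.
by apply: prop0; rewrite // inE ?xI ?yI.
Qed.

(** Each boundary vertex weighs at least 1, as [k] is positive. *)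
Lemma boundary_le (X Y : {set T}) : 0 < k ->
  #|[set v in Y | nbrs (X :\: Y) v != set0]| <= potential X Y.
Proof.
move=> k0; rewrite -sum1_card /potential big_mkcond [leqRHS]big_mkcond /=.
apply: leq_sum => v _; rewrite !inE; case: (v \in Y) => //=.
case: ifP => //; rewrite -card_gt0 /weight => v0.
by rewrite leq_min k0.
Qed.

Lemma colors_of_separations (c : nat) (X : {set T}) : 0 < k -> 0 < c ->
  (forall Y, Y \subset X ->
     (exists col, colors Y c col) \/ (exists A B, separation Y A B)) ->
  exists col, colors X (c + (2 * k ^ 2 - 1)) col.
Proof.
move=> k0 c0; have [m] := ubnP #|X|; elim: m X => // m IHm X szX dich.
have IH (I : {set T}) x : x \in X -> x \in I ->
    exists col, colors (X :\: I) (c + (2 * k ^ 2 - 1)) col.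
  move=> xX xI; apply: IHm => [|Y YX]; last first.
    exact/dich/(subset_trans YX)/subsetDl.
  apply: leq_trans (proper_card _) (ltnSE szX); rewrite properE subsetDl /=.
  by apply/subsetPn; exists x; rewrite // inE xI.
have k2 : 0 < k ^ 2 by rewrite expn_gt0 k0.
have [->|X0] := eqVneq X set0.
  by exists (fun=> 0); split=> [x|x y]; rewrite inE.
have [/existsP[v /andP[vX vlow]]|high] :=
    boolP [exists v in X, #|nbrs X v| < 2 * k ^ 2].
  have [col0 col0P] := IH [set v] v vX (set11 v).
  (* A single vertex takes one colour; its at most [2k^2 - 1] neighbours leave one free because
     [c >= 1]. *)
  have col1P : colors [set v] 1 (fun=> 0).
    by split=> // x y /set1P-> /set1P->; rewrite e_irr.
  apply: (colors_extend (N := nbrs X v)) col0P col1P _ _; first lia.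
  by move=> x y /set1P->; rewrite !inE => /andP[_ ->] ->.
have deg_ge v : v \in X -> 2 * k ^ 2 <= #|nbrs X v|.
  by move=> vX; move: high; rewrite negb_exists_in => /forall_inP/(_ v vX); lia.
have [Y [YX iY pY nosep]] := inseparable_piece_exists k0 deg_ge X0.
have [[col1 col1P]|[A [B /nosep//]]] := dich Y YX.
(* Outside [I], the neighbours of [I] lie on the boundary of [Y], which by [boundary_le] has at most
   [2k^2 - 1] vertices; this leaves [c] colours for [I]. *)
pose I := [set v in Y | nbrs (X :\: Y) v == set0].
have IY : I \subset Y by apply/subsetP => v; rewrite inE => /andP[].
have /existsP[u /andP[uY u0]] := iY.
have uI : u \in I by rewrite inE uY.
have [col0 col0P] := IH I u (subsetP YX u uY) uI.
apply: (colors_extend (N := [set v in Y | nbrs (X :\: Y) v != set0]))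
  col0P (colorsS IY col1P) _ _; first by have := boundary_le X Y k0; lia.
move=> x y; rewrite !inE => /andP[xY /eqP x0] /andP[+ yX] exy.
case yY: (y \in Y) => //=; have := in_set0 y.
by rewrite -x0 !inE yY yX exy.
Qed.

End FiniteGraph.
Local Open Scope fset_scope.

(** * Colourings and cliques expressed in the ambient vertex type *)

Section Graphs.

Variable U : choiceType.
Implicit Types (G H : graph U) (X Y A B K : {fset U}) (x y : U).

Lemma adjC G x y : adj G x y = adj G y x.
Proof. by rewrite /adj fsetUC. Qed.

Lemma adj_irr G x : adj G x x = false.
Proof.
by apply/negP => /graphP/andP[_]; rewrite fsetUid cardfs1.
Qed.

Lemma adj_induced G X x y :
  adj (induced G X) x y = [&& adj G x y, x \in X & y \in X].
Proof. by rewrite /adj /= !inE /= fsubUset !fsub1set. Qed.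

Lemma induced_induced G X Y :
  Y `<=` X -> induced (induced G X) Y = induced G Y.
Proof.
move=> YX; apply: graph_eq => /=.
  by rewrite -fsetIA (fsetIidPr YX).
apply/fsetP => d; rewrite !inE /= -andbA; congr (_ && _).
by apply: andb_idl => dY; apply: fsubset_trans YX.
Qed.

Lemma colorableP G c :
  colorable G c <->
  exists col : U -> nat, (forall x, x \in vertices G -> col x < c) /\
    (forall x y, x \in vertices G -> y \in vertices G -> adj G x y ->
       col x != col y).
Proof.
split=> [/existsP[col /forallP colP]|[col [ltc colP]]].
  exists (fun x => if insub x is Some v then val (col v) else 0%N).
  split=> [x xG|x y xG yG exy]; rewrite !insubT; first exact: ltn_ord.
  by move/forallP: (colP [` xG]) => /(_ [` yG])/implyP; apply.
apply/existsP; exists [ffun v => Ordinal (ltc (val v) (valP v))].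
apply/forallP => v; apply/forallP => w; apply/implyP => evw.
rewrite !ffunE -val_eqE /=; apply: colP evw; exact: valP.
Qed.

Lemma colorable_chi G : colorable G (chi G).
Proof. by rewrite /chi; case: ex_minnP. Qed.

Lemma chi_le G c : colorable G c -> chi G <= c.
Proof. by rewrite /chi; case: ex_minnP => m _ + h; apply. Qed.

Lemma colorable_widen G c d : c <= d -> colorable G c -> colorable G d.
Proof.
move=> cd /colorableP[col [ltc colP]]; apply/colorableP; exists col.
by split=> // x /ltc; move/leq_trans; apply.
Qed.

(** Together with [omega_witness], this replaces cliques in the type [vertices G] by finite sets in
    [U], which can be compared across induced subgraphs. *)
Lemma omega_ge G K : K `<=` vertices G ->
  (forall x y, x \in K -> y \in K -> x != y -> adj G x y) ->
  #|` K| <= omega G.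
Proof.
move=> KG clK; pose S := [set v : vertices G | val v \in K].
have -> : #|` K| = #|S|.
  rewrite cardfE; pose h (v : K) : vertices G := [` fsubsetP KG _ (valP v)].
  have h_inj : injective h by move=> v w /(congr1 val) /= /val_inj.
  rewrite -cardsT -(card_imset _ h_inj); apply: eq_card => v; rewrite inE.
  apply/imsetP/idP => [[w _ ->]|vK]; first exact: (valP w).
  by exists [` vK] => //; apply: val_inj.
apply: leq_bigmax_cond; apply/forall_inP => v; rewrite inE => vS.
by apply/forall_inP => w; rewrite inE => wS; apply/implyP; apply: clK.
Qed.

Lemma omega_witness G : exists K, [/\ K `<=` vertices G,
  forall x y, x \in K -> y \in K -> x != y -> adj G x y & #|` K| = omega G].
Proof.
have cl0 : clique (G := G) set0 by apply/forall_inP => x; rewrite inE.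
have cl_gt0 : 0 < #|@clique _ G| by apply/card_gt0P; exists set0.
rewrite /omega.
have [S clS ->] := eq_bigmax_cond (fun S : {set vertices G} => #|S|) cl_gt0.
exists [fset val v | v in S]; split.
- by apply/fsubsetP => _ /imfsetP[v /= _ ->]; apply: valP.
- move=> _ _ /imfsetP[v /= vS ->] /imfsetP[w /= wS ->] vw.
  by move/forall_inP: clS => /(_ v vS)/forall_inP/(_ w wS)/implyP; apply.
- by rewrite card_imfset /= ?cardE //; apply: val_inj.
Qed.

Lemma omega_induced G X Y :
  Y `<=` X -> omega (induced G Y) <= omega (induced G X).
Proof.
move=> YX; have [K [KY clK <-]] := omega_witness (induced G Y).
apply: omega_ge => [|x y xK yK xy].
  by apply: fsubset_trans KY _; apply: fsetIS.
have := clK x y xK yK xy; rewrite !adj_induced => /and3P[-> xY yY] /=.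
by rewrite !(fsubsetP YX).
Qed.

(** * Separations in the gluing closure *)

Definition vertex_separation (k : nat) G Y A B : Prop :=
  [/\ Y = A `|` B, A `\` B != fset0, B `\` A != fset0, #|` A `&` B| <= k
    & forall x y, x \in A `\` B -> y \in B `\` A -> ~~ adj G x y].

(** Induction on the construction: a set inside one of the two glued graphs inherits its
    alternative, and any other set is separated by its traces on the two. *)
Lemma gluing_closure_separation k (cls : graph U -> Prop) G Y :
  gluing_closure k cls G -> Y `<=` vertices G ->
  (exists H, [/\ cls H, Y `<=` vertices H & induced G Y = induced H Y]) \/
  (exists A B, vertex_separation k G Y A B).
Proof.
move=> clG; elim: clG Y => {G} [G clsG Y YG|G1 G2 G _ IH1 _ IH2 cS gl Y].
  by left; exists G.
(* Both alternatives lift from a part [G'] to [G], because [G'] is induced in [G]. *)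
have transfer G' : induced G (vertices G') = G' -> Y `<=` vertices G' ->
  (exists H, [/\ cls H, Y `<=` vertices H & induced G' Y = induced H Y]) \/
  (exists A B, vertex_separation k G' Y A B) ->
  (exists H, [/\ cls H, Y `<=` vertices H & induced G Y = induced H Y]) \/
  (exists A B, vertex_separation k G Y A B).
  move=> GG' YG' [[H [clsH YH eqH]]|[A [B [YE nA nB cAB anti]]]]; [left|right].
    by exists H; split; rewrite // -eqH -[in RHS]GG' induced_induced.
  exists A, B; split=> // x y xA yB; have := anti x y xA yB.
  rewrite -{1}GG' adj_induced.
  have xG : x \in vertices G'.
    by move: xA; rewrite inE => /andP[_ xA]; rewrite (fsubsetP YG') // YE inE xA.
  have yG : y \in vertices G'.
    by move: yB; rewrite inE => /andP[_ yB]; rewrite (fsubsetP YG') // YE inE yB orbT.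
  by rewrite xG yG !andbT.
have [Y1|nY1] := boolP (Y `<=` vertices G1).
  by move=> _; apply: transfer (glued_induced1 gl) Y1 (IH1 Y Y1).
have [Y2|nY2] := boolP (Y `<=` vertices G2).
  by move=> _; apply: transfer (glued_induced2 gl) Y2 (IH2 Y Y2).
rewrite (glued_vertices gl) => YG; right.
exists (Y `&` vertices G1), (Y `&` vertices G2).
have YE : Y = Y `&` vertices G1 `|` Y `&` vertices G2.
  by rewrite -fsetIUr; apply/esym/fsetIidPl.
split=> //.
- apply: contraNneq nY2 => /eqP; rewrite fsetD_eq0 => sub.
  by rewrite YE fsubUset fsubsetIr (fsubset_trans sub) // fsubsetIr.
- apply: contraNneq nY1 => /eqP; rewrite fsetD_eq0 => sub.
  by rewrite YE fsubUset fsubsetIr (fsubset_trans sub) // fsubsetIr.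
- by apply: leq_trans cS; apply/fsubset_leq_card/fsetISS; apply: fsubsetIr.
move=> x y; rewrite !inE !negb_and.
move=> /and3P[+ xY x1] /and3P[+ yY y2]; rewrite xY yY /= => x2 y1.
by apply: (glued_anticomplete gl); rewrite !inE ?x1 ?y2 ?andbT.
Qed.

(** Carries [colors_of_separations] over to [U], with [X] itself as the finite vertex type; subsets
    of that type correspond to their images under [val]. *)
Lemma colorable_induced_of_separations k c G X : 0 < k -> 0 < c ->
  X `<=` vertices G ->
  (forall Y, Y `<=` X -> colorable (induced G Y) c \/
     (exists A B, vertex_separation k G Y A B)) ->
  colorable (induced G X) (c + (2 * k ^ 2 - 1)).
Proof.
move=> k0 c0 XG dich; pose e : rel X := fun v w => adj G (val v) (val w).
have e_sym : symmetric e by move=> v w; apply: adjC.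
have e_irr : irreflexive e by move=> v; apply: adj_irr.
have valX (S : {set X}) : [fset val v | v in S] `<=` X.
  by apply/fsubsetP => _ /imfsetP[v /= _ ->]; apply: valP.
have [|col [ltc colP]] :=
    @colors_of_separations X e k e_sym e_irr c setT k0 c0.
  move=> S _; pose Y := [fset val v | v in S].
  have memY (v : X) : (val v \in Y) = (v \in S).
    by rewrite mem_imfset //=; apply: val_inj.
  have YX : Y `<=` X := valX S.
  have inY x : x \in X -> x \in Y -> x \in vertices (induced G Y).
    by move=> xX xY; rewrite !inE xY (fsubsetP XG).
  have [/colorableP[col [ltc colP]]|[A [B [YE nA nB cAB anti]]]] := dich Y YX.
    left; exists (col \o val); split=> [v vS|v w vS wS evw] /=.
      by apply: ltc; apply: inY (valP v) _; rewrite memY.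
    apply: colP; [by apply: inY (valP v) _; rewrite memY
                 |by apply: inY (valP w) _; rewrite memY|].
    by rewrite adj_induced !memY vS wS andbT; apply/andP.
  right; exists [set v : X | val v \in A], [set v : X | val v \in B].
  have AX : A `<=` X by apply: fsubset_trans YX; rewrite YE fsubsetUl.
  have BX : B `<=` X by apply: fsubset_trans YX; rewrite YE fsubsetUr.
  split.
  - by apply/setP => v; rewrite !inE -memY YE inE.
  - have [x xA] := fset0Pn _ nA; apply/set0Pn.
    have xX : x \in X by move: xA; rewrite inE => /andP[_ /(fsubsetP AX)].
    by exists [` xX]; move: xA; rewrite !inE.
  - have [x xB] := fset0Pn _ nB; apply/set0Pn.
    have xX : x \in X by move: xB; rewrite inE => /andP[_ /(fsubsetP BX)].
    by exists [` xX]; move: xB; rewrite !inE.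
  - apply: leq_trans cAB.
    set S' := _ :&: _.
    have -> : #|S'| = #|` [fset val v | v in S']|.
      by rewrite card_imfset /= ?cardE //; apply: val_inj.
    apply/fsubset_leq_card/fsubsetP => _ /imfsetP[v /= + ->].
    by rewrite !inE.
  - by move=> v w; rewrite !inE => vA wB; apply: anti; rewrite !inE.
apply/colorableP.
exists (fun x => if insub x is Some v then col v else 0%N).
have inX x : x \in vertices (induced G X) -> x \in X by rewrite inE => /andP[].
split=> [x /inX xX|x y /inX xX /inX yX]; rewrite !insubT.
  by apply: ltc; rewrite inE.
by rewrite adj_induced => /and3P[exy _ _]; apply: colP; rewrite ?inE.
Qed.

End Graphs.

(** * Passage to the real-valued bound *)

Import Order.TTheory GRing.Theory Num.Theory.

Local Open Scope ring_scope.

Theorem theorem3p2 (R : realType) (U : choiceType) (k : nat) (hk : (0 < k)%N)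
    (cls : graph U -> Prop) (f : nat -> R)
    (hmono : forall m n : nat, (m <= n)%N -> f m <= f n)
    (hf : chi_bounded_by cls f) :
  chi_bounded_by (gluing_closure k cls)
    (fun n : nat => f n + 2%:R * k%:R ^+ 2 - 1).
Proof.
move=> G clG X XG; set F := f _.
(* Monotonicity of [f] lets the single value [F] serve all subsets of [X]. *)
have base Y : (Y `<=` X)%fset ->
    (exists H, [/\ cls H, (Y `<=` vertices H)%fset & induced G Y = induced H Y]) ->
    (chi (induced G Y))%:R <= F.
  move=> YX [H [clsH YH eqH]]; rewrite eqH; apply: le_trans (hf H clsH Y YH) _.
  by rewrite -eqH; apply/hmono/omega_induced.
have dich Y YX := gluing_closure_separation clG (fsubset_trans (YX : Y `<=` X)%fset XG).
(* A separation needs two distinct vertices, so a smaller set falls under the class. The empty set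
   yields [0 <= F], and a singleton yields [0 < c] below. *)
have small Y : (Y `<=` X)%fset -> (#|` Y| <= 1)%N -> (chi (induced G Y))%:R <= F.
  move=> YX Y1; have [/(base Y YX)//|[A [B [YE nA nB _ _]]]] := dich Y YX.
  have [x] := fset0Pn _ nA; have [y] := fset0Pn _ nB.
  rewrite !inE => /andP[yA yB] /andP[xB xA].
  have: (#|` [fset x; y]| <= #|` Y|)%N.
    by apply: fsubset_leq_card; rewrite YE fsubUset !fsub1set !inE xA yB orbT.
  rewrite cardfs2; have -> : x != y by apply: contraNneq xB => ->.
  by move: Y1; lia.
have F0 : 0 <= F.
  by apply: le_trans (small fset0 (fsub0set _) _); rewrite ?cardfs0 ?ler0n.
have k2 : (0 < k ^ 2)%N by rewrite expn_gt0 hk.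
have k2R : 2%:R * k%:R ^+ 2 - 1 = (2 * k ^ 2 - 1)%N%:R :> R.
  by rewrite natrB ?natrM ?natrX //; lia.
rewrite -addrA k2R.
(* For empty [X], [F] may be less than 1, and rounding it down would leave [c = 0]. *)
have [X0|/fset0Pn[x xX]] := eqVneq X fset0.
  apply: (le_trans (small X _ _)); rewrite ?X0 ?cardfs0 //.
  by rewrite lerDl.
(* Chromatic numbers are integers, so rounding [F] down loses nothing. *)
pose c := Num.truncn F.
have chi_c Y : (chi (induced G Y))%:R <= F -> (chi (induced G Y) <= c)%N.
  by rewrite /c truncn_ge_nat.
have c0 : (0 < c)%N.
  have x1 : ([fset x] `<=` X)%fset by rewrite fsub1set.
  apply: leq_trans (chi_c [fset x]%fset (small _ x1 _)); rewrite ?cardfs1 //.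
  have /colorableP[col [ltc _]] := colorable_chi (induced G [fset x]%fset).
  by apply: leq_ltn_trans (ltc x _) => //; rewrite !inE eqxx (fsubsetP XG).
apply: (@le_trans _ _ ((c + (2 * k ^ 2 - 1))%N%:R)).
  rewrite ler_nat; apply/chi_le/colorable_induced_of_separations => // Y YX.
  have [/(base Y YX) le|] := dich Y YX; [left|by right].
  exact: colorable_widen (chi_c _ le) (colorable_chi _).
by rewrite natrD lerD2r /c truncn_le.
Qed.
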